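(* Let $G$ be a locally compact group with a proper local right action on a locally compact space $X$, defined on the open set $\Gamma\subseteq X\times G$. Let $f$ be a non-zero polynomial function in $C_c(X)$. Let $C\subseteq X$ be a compact subset and $G_0$ an open subgroup of $G$ such that $C\cdot G_0=C$ (that is, $(x,q)\in\Gamma$ for all $x\in C$, $q\in G_0$, and $\{x\cdot q\mid x\in C,\ q\in G_0\}=C$) and such that $f$ belongs to a finite-dimensional subspace $F$ of the space of functions in $C_c(X)$ with support in $C$ satisfying $q\cdot g\in F$ for all $g\in F$, $q\in G_0$. Then $G_0$ is a compact open subgroup of $G$.
   Context: Locally compact groups and spaces are Hausdorff. $e$ is the identity of $G$; a neighborhood of $e$ always means an open neighborhood. $C_c(X)$ is the space of continuous complex functions on $X$ with compact support; the support is the closure of the set where the function is non-zero. Local right action of $G$ on $X$: a continuous map $(x,p)\mapsto x\cdot p$ from an open subset $\Gamma\subseteq X\times G$ to $X$ such that (i) $(x,e)\in\Gamma$ and $x\cdot e=x$ for all $x\in X$; (ii) for $(x,p)\in\Gamma$ and $q\in G$: $(x,pq)\in\Gamma$ if and only if $(x\cdot p,q)\in\Gamma$, and in that case $x\cdot(pq)=(x\cdot p)\cdot q$. The local action is proper if the map $(x,p)\mapsto(x,x\cdot p)$ from $\Gamma$ to $X\times X$ is proper, i.e. the inverse image of every compact subset of $X\times X$ is a compact subset of $\Gamma$. For $f\in C_c(X)$ and $p\in G$ define $(p\cdot f)(x)=f(x\cdot p)$ if $(x,p)\in\Gamma$ and $(p\cdot f)(x)=0$ otherwise. Let $V_f=\{p\in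 G\mid (x,p^{-1})\in\Gamma\text{ for all }x\text{ in the support of }f\}$; this is an open neighborhood of $e$, and $p\cdot f\in C_c(X)$ for $p\in V_f$. $f\in C_c(X)$ is polynomial if there are a neighborhood $V$ of $e$ with $V\subseteq V_f$ and a finite-dimensional subspace $F'$ of $C_c(X)$ with $v\cdot f\in F'$ for all $v\in V$. *)

(* Defs.v *)
From HB Require Import structures.
From mathcomp Require Import all_boot all_order all_algebra.
From mathcomp Require Import all_classical all_reals all_analysis.
From mathcomp Require Export complex.

Set Implicit Arguments.
Unset Strict Implicit.
Unset Printing Implicit Defensive.

Import GRing.Theory.
Import numFieldNormedType.Exports.

Local Open Scope classical_set_scope.
Local Open Scope ring_scope.
Local Open Scope complex_scope.

(* The modulus topology on R[i]; the library only provides it on the alias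
   R[i]^o. *)
HB.instance Definition _ (R : realType) := NormedModule.copy R[i] R[i]^o.

HB.structure Definition PreTopologicalGroup :=
  {G of Topological G & Group G}.

HB.mixin Record PreTopologicalGroup_isTopologicalGroup G
    & PreTopologicalGroup G := {
  mulg_continuous : continuous (fun x : G * G => (x.1 * x.2)%g) ;
  invg_continuous : continuous (fun x : G => x^-1%g) ;
}.

#[short(type="topologicalGroupType")]
HB.structure Definition TopologicalGroup :=
  {G of PreTopologicalGroup G & PreTopologicalGroup_isTopologicalGroup G}.

Definition locally_compact_hausdorff (T : topologicalType) :=
  hausdorff_space T /\ locally_compact [set: T].

Definition open_subgroup (G : topologicalGroupType) (H : set G) :=
  open H /\ group_closed [in H].

Definition finite_dim_subspace (K : pzRingType) (V : lmodType K)
    (F : set V) :=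
  GRing.submod_closed [in F] /\
  exists n (b : 'I_n -> V), (forall i, F (b i)) /\
    forall u, F u -> exists a : 'I_n -> K, u = \sum_(i < n) a i *: b i.
Arguments finite_dim_subspace K {V} F.

Section CompactSupport.
Variables (R : realType) (X : topologicalType).

Definition closed_support (f : X -> R[i]) : set X :=
  closure [set x | f x != 0].

Definition Cc : set (X -> R[i]) :=
  [set f | continuous f /\ compact (closed_support f)].

End CompactSupport.

Section LocalAction.
Variables (X : topologicalType) (G : topologicalGroupType).

(* act is a total function of which only the restriction to Gamma matters:
   its values outside Gamma are unconstrained. *)
Record local_right_action (Gamma : set (X * G)) (act : X * G -> X) : Prop := {
  local_action_open : open Gamma ;
  local_action_continuous : {within Gamma, continuous act} ;
  local_action1 : forall x, Gamma (x, 1%g) /\ act (x, 1%g) = x ;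
  local_actionM : forall x p q, Gamma (x, p) ->
    (Gamma (x, (p * q)%g) <-> Gamma (act (x, p), q)) /\
    (Gamma (x, (p * q)%g) -> act (x, (p * q)%g) = act (act (x, p), q))
}.

(* A subset of Gamma is compact in Gamma iff it is compact in X * G. *)
Definition proper_local_action (Gamma : set (X * G)) (act : X * G -> X) :=
  forall K : set (X * X), compact K ->
    compact (Gamma `&` (fun z => (z.1, act z)) @^-1` K).

Variables (R : realType) (Gamma : set (X * G)) (act : X * G -> X).

Definition translate (p : G) (f : X -> R[i]) : X -> R[i] :=
  fun x => if `[< Gamma (x, p) >] then f (act (x, p)) else 0.

Definition translation_domain (f : X -> R[i]) : set G :=
  [set p | forall x, closed_support f x -> Gamma (x, p^-1%g)].

Definition polynomial_function (f : X -> R[i]) :=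
  Cc f /\
  exists V : set G, [/\ open V, V 1%g, V `<=` translation_domain f &
    exists F' : set (X -> R[i]), [/\ finite_dim_subspace R[i] F',
      F' `<=` @Cc R X & forall v, V v -> F' (translate v f)]].

End LocalAction.

(* Main.v *)
Require Import Defs.
From mathcomp Require Import all_boot all_order all_algebra.
From mathcomp Require Import all_classical all_reals all_analysis.

Local Open Scope classical_set_scope.
Local Open Scope ring_scope.
Local Open Scope complex_scope.

(** Compactness comes from the properness of the action. A non-zero function
    supported in [C] provides a point [x0] of [C], and the orbit of [x0] under
    [G0] stays in the compact set [C]. Hence [{x0} * G0] lies in the inverse
    image of the compact set [{x0} * C] under [(x, p) |-> (x, x . p)], which is
    compact by properness, so [G0] lies in a compact subset of [G], namely the
    projection of that inverse image. An open subgroup is closed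
    ([open_subgroup_closed]), and a closed subset of a compact set is compact. *)

(** If [p] is adherent to [H], its neighborhood [p H] meets [H] in some
    [q = p h], so [p = q h^-1] lies in [H]. *)
Lemma open_subgroup_closed (G : topologicalGroupType) (H : set G) :
  open_subgroup H -> closed H.
Proof.
move=> [oH [H1 HB]] p clHp.
have pH_nbhs : nbhs p [set q | H (p^-1 * q)%g].
  apply: open_nbhs_nbhs; split; last first.
    by rewrite /= mulVg; move: H1; rewrite inE.
  apply: (open_comp (f := fun q : G => (p^-1 * q)%g)) => // q _.
  apply: (@continuous_comp _ _ _ (fun q : G => (p^-1%g, q))
    (fun x : G * G => (x.1 * x.2)%g)); last exact: mulg_continuous.
  by apply: cvg_pair; [exact: cvg_cst | exact: cvg_id].
have [q [Hq /= Hpq]] := clHp _ pH_nbhs.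
have -> : p = (q / (p^-1 * q))%g by rewrite invgM invgK mulVKg.
by apply/set_mem/HB; apply/mem_set.
Qed.

(** This set is the projection to [G] of the inverse image of the compact set
    [{x} * C] under the map that properness speaks of. *)
Lemma proper_local_action_transporter_compact (X : topologicalType)
    (G : topologicalGroupType) (Gamma : set (X * G)) (act : X * G -> X)
    (x : X) (C : set X) :
  proper_local_action Gamma act -> compact C ->
  compact [set p | Gamma (x, p) /\ C (act (x, p))].
Proof.
move=> act_proper C_compact.
have K_compact := act_proper _ (compact_setX (@compact_set1 _ x) C_compact).
have -> : [set p | Gamma (x, p) /\ C (act (x, p))] =
    snd @` (Gamma `&` (fun z => (z.1, act z)) @^-1` ([set x] `*` C)).
  apply/seteqP; split=> [p [Gp Cp]|p]; first by exists (x, p).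
  by move=> [[y q] [/= Gyq [/= yx Cyq]] <-]; rewrite -yx.
apply: continuous_compact K_compact.
by apply: continuous_subspaceT => z; exact: cvg_snd.
Qed.

Theorem proposition3p18 (R : realType) (G : topologicalGroupType)
    (X : topologicalType)
    (lcG : locally_compact_hausdorff G) (lcX : locally_compact_hausdorff X)
    (Gamma : set (X * G)) (act : X * G -> X)
    (actP : local_right_action Gamma act)
    (act_proper : proper_local_action Gamma act)
    (f : X -> R[i]) (f_poly : polynomial_function Gamma act f)
    (f_neq0 : f <> 0)
    (C : set X) (G0 : set G)
    (C_compact : compact C) (G0_open_subgroup : open_subgroup G0)
    (CG0_Gamma : forall x q, C x -> G0 q -> Gamma (x, q))
    (CG0 : [set act (x, q) | x in C & q in G0] = C)
    (F : set (X -> R[i])) (F_fin_dim : finite_dim_subspace R[i] F)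
    (F_supp : F `<=` [set g | Cc g /\ closed_support g `<=` C])
    (F_stable : forall g q, F g -> G0 q -> F (translate Gamma act q g))
    (Ff : F f) :
  compact G0 /\ open_subgroup G0.
Proof.
split=> //.
have [x0 fx0] : exists x, f x != 0.
  apply: contrapT => /forallNP f0; apply: f_neq0; apply/funext => x.
  by apply/eqP/negPn/negP/f0.
have Cx0 : C x0 by have [_] := F_supp _ Ff; apply; exact: subset_closure.
apply: (subclosed_compact (open_subgroup_closed _ _ G0_open_subgroup)).
  exact: proper_local_action_transporter_compact act_proper C_compact.
move=> q G0q; split; first exact: CG0_Gamma Cx0 G0q.
by rewrite -CG0; exists x0 => //; exists q.
Qed.
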